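(* Let $D$ be a finite or infinite digraph, and let $D^-$ be the digraph obtained from $D$ by deleting all sinks of $D$ (vertices of out-degree $0$). Then: (1) A set $A\subseteq X(D)$ is an arc-reaching set of $D$ if and only if $A=P\cup Q$ where $P$ is a point-reaching set of $D^-$ and $Q$ is a (arbitrary) set of sinks of $D$. (2) The arc-bases of $D$ are exactly the sets $B\setminus I$, where $B$ is a point-basis of $D$ and $I$ is the set of isolates of $D$.
   Context: A digraph $D$ has vertex set $X(D)$ and arc set $\mathcal{U}(D)$ (arcs are ordered pairs of distinct vertices); $D$ may be infinite. A vertex $v$ is reachable from $u$ if there is a directed path (possibly of length $0$) from $u$ to $v$. An isolate is a vertex of in-degree and out-degree $0$; a sink is a vertex of out-degree $0$. A point-reaching set of $D$ is a set $S\subseteq X(D)$ such that every vertex of $D$ is reachable from some vertex of $S$; a point-basis is an inclusion-minimal point-reaching set. An arc-reaching set of $D$ is a set $S\subseteq X(D)$ such that for every arc $(u,v)$ of $D$ the vertex $u$ is reachable from some vertex of $S$ (equivalently, some directed walk starting in $S$ contains the arc); an arc-basis is an inclusion-minimal arc-reaching set. *)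

(* Defs.v *)
From mathcomp Require Import all_boot.
From mathcomp Require Import boolp classical_sets.

Set Implicit Arguments.
Unset Strict Implicit.
Unset Printing Implicit Defensive.

Local Open Scope classical_set_scope.

(* Vertices form a subset of an ambient type V rather than a whole type, so
   that sets of vertices of D and of a subdigraph of D have the same type. *)
Record digraph (V : Type) := Digraph {
  vertices : set V;
  arcs : set (V * V);
  arcs_vertices : forall u v, arcs (u, v) -> vertices u /\ vertices v;
  arcs_distinct : forall u v, arcs (u, v) -> u <> v
}.

Section Digraph.
Variables (V : Type) (D : digraph V).
Implicit Types (u v : V) (S T : set V).

(* The path is p 0, ..., p n; the values of p beyond n are irrelevant. *)
Definition dipath (u v : V) (n : nat) (p : nat -> V) : Prop :=
  [/\ p 0 = u, p n = v,
      forall i, i <= n -> vertices D (p i),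
      forall i, i < n -> arcs D (p i, p i.+1)
    & forall i j, i <= n -> j <= n -> p i = p j -> i = j].

Definition reachable (u v : V) : Prop := exists n p, dipath u v n p.

Definition out_nbrs (v : V) : set V := [set w | arcs D (v, w)].
Definition in_nbrs (v : V) : set V := [set u | arcs D (u, v)].

Definition sinks : set V := [set v | vertices D v /\ out_nbrs v = set0].

Definition isolates : set V :=
  [set v | [/\ vertices D v, in_nbrs v = set0 & out_nbrs v = set0]].

Definition point_reaching (S : set V) : Prop :=
  S `<=` vertices D /\
  forall v, vertices D v -> exists2 s, S s & reachable s v.

Definition arc_reaching (S : set V) : Prop :=
  S `<=` vertices D /\
  forall u v, arcs D (u, v) -> exists2 s, S s & reachable s u.

Definition inclusion_minimal (P : set V -> Prop) (S : set V) : Prop :=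
  P S /\ forall T, P T -> T `<=` S -> T = S.

Definition point_basis : set V -> Prop := inclusion_minimal point_reaching.
Definition arc_basis : set V -> Prop := inclusion_minimal arc_reaching.

Section Deletion.
Variable S : set V.

Let X : set V := vertices D `\` S.
Let U : set (V * V) := [set a | [/\ arcs D a, ~ S a.1 & ~ S a.2]].

Fact del_arcs_vertices u v : U (u, v) -> X u /\ X v.
Proof. by move=> [Duv Su Sv]; have [Xu Xv] := arcs_vertices Duv; split; split. Qed.

Fact del_arcs_distinct u v : U (u, v) -> u <> v.
Proof. by move=> [Duv _ _]; exact: arcs_distinct Duv. Qed.

Definition delete_vertices : digraph V :=
  Digraph del_arcs_vertices del_arcs_distinct.

End Deletion.

Definition delete_sinks : digraph V := delete_vertices sinks.

End Digraph.

(* Main.v *)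
Require Import Defs.
From mathcomp Require Import all_boot.
From mathcomp Require Import boolp classical_sets.

(**
  A sink reaches only itself and is the tail of no arc, so sinks are irrelevant
  to arc-reaching, and a directed path ending at a non-sink avoids all sinks;
  this gives (1).  For (2), adding the isolates turns an arc-reaching set into
  a point-reaching one, and removing them turns a point-reaching set, which
  necessarily contains them all, into an arc-reaching one.  Both operations are
  monotone and, as an arc-basis contains no sink, they are mutually inverse on
  bases, so they exchange the minimal sets.
*)

Set Implicit Arguments.
Unset Strict Implicit.
Unset Printing Implicit Defensive.

Local Open Scope classical_set_scope.

Section Reachability.
Variables (V : Type) (D : digraph V).
Implicit Types (u v w : V) (S : set V).

Lemma arc_not_sink u v : arcs D (u, v) -> ~ sinks D u.
Proof. by move=> uv [_ N0]; have : out_nbrs D u v by []; rewrite N0. Qed.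

Lemma not_sink_arc v : vertices D v -> ~ sinks D v -> exists w, arcs D (v, w).
Proof.
move=> Dv Nv; have [/eqP N0|/set0P[w vw]] := boolP (out_nbrs D v == set0).
  by case: Nv.
by exists w.
Qed.

Lemma isolates_sub_sinks : isolates D `<=` sinks D.
Proof. by move=> v []. Qed.

Lemma reachable_refl v : vertices D v -> reachable D v v.
Proof.
move=> Dv; exists 0, (fun=> v); split=> // i j.
by rewrite !leqn0 => /eqP-> /eqP->.
Qed.

(** Since paths may not repeat a vertex, [w] cannot always be appended: if it already lies on the
    path, the path is cut there instead. *)
Lemma reachable_arc u v w : reachable D u v -> arcs D (v, w) -> reachable D u w.
Proof.
move=> [n [p [p0 pn Dp Ap inj_p]]] vw.
have [[i [le_in pi]]|fresh] := pselect (exists i, i <= n /\ p i = w).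
  exists i, p; split=> // [j le_ji|j lt_ji|j k le_ji le_ki].
  - exact/Dp/(leq_trans le_ji).
  - exact/Ap/(leq_trans lt_ji).
  - by apply: inj_p; [exact: leq_trans le_ji _|exact: leq_trans le_ki _].
have neq_w i : i <= n -> p i <> w by move=> le_in pi; apply: fresh; exists i.
have [_ Dw] := arcs_vertices vw.
exists n.+1, (fun i => if i <= n then p i else w); split=> /=.
- exact: p0.
- by rewrite ltnn.
- by move=> i _; case: ifP => // /Dp.
- move=> i; rewrite ltnS => le_in; rewrite le_in.
  by case: ltngtP le_in => // [/Ap//|-> _]; rewrite pn.
- move=> i j le_i le_j.
  case: (leqP i n) (leqP j n) => [le_in|lt_ni] [le_jn|lt_nj].
  + exact: inj_p.
  + by move/neq_w; case.
  + by move/esym/neq_w; case.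
  (* Both indices lie in the range from [n.+1] to [n.+1], so they agree. *)
  + by move=> _; apply/eqP; rewrite eqn_leq (leq_trans le_i) // (leq_trans le_j).
Qed.

(** A path of positive length leaves [u] by its first arc and enters [v] by its last. *)
Lemma reachable_ends u v :
  reachable D u v -> u = v \/ ~ sinks D u /\ in_nbrs D v !=set0.
Proof.
move=> [[|n] [p [<- <- _ Ap _]]]; [by left|right].
by split; [exact: arc_not_sink (Ap 0 _)|exists (p n); exact: Ap].
Qed.

Lemma reachable_from_sink u v : sinks D u -> reachable D u v -> u = v.
Proof. by move=> Su /reachable_ends[//|[]]. Qed.

Lemma reachable_isolate u v : isolates D v -> reachable D u v -> u = v.
Proof.
by move=> [_ N0 _] /reachable_ends[//|[_]]; rewrite N0 => -[].
Qed.

Lemma reachable_delete_vertices S u v :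
  reachable (delete_vertices D S) u v -> reachable D u v.
Proof.
move=> [n [p [p0 pn Dp Ap inj_p]]]; exists n, p; split=> // i.
  by move=> /Dp[].
by move=> /Ap[].
Qed.

Lemma reachable_delete_sinks u v :
  ~ sinks D v -> reachable D u v -> reachable (delete_sinks D) u v.
Proof.
move=> Nv [n [p [p0 pn Dp Ap inj_p]]].
(* Each vertex before the last is the tail of the next arc; the last is [v]. *)
have Np i : i <= n -> ~ sinks D (p i).
  rewrite leq_eqVlt => /predU1P[->|/Ap/arc_not_sink//].
  by rewrite pn.
exists n, p; split=> // i le_in.
- by split; [exact: Dp|exact: Np].
- by split; [exact: Ap|exact/Np/ltnW|exact: Np].
Qed.

Lemma reachable_delete_sinks_source u v :
  reachable (delete_sinks D) u v -> ~ sinks D u.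
Proof. by move=> [n [p [<- _ Dp _ _]]]; have [] := Dp 0 isT. Qed.

End Reachability.

Section Reaching.
Variables (V : Type) (D : digraph V).
Implicit Types A B S : set V.

(** A sink reaching the tail of an arc would be that tail, so the source already used is never in
    [S]. *)
Lemma arc_reaching_setD_sinks A S :
  S `<=` sinks D -> arc_reaching D A -> arc_reaching D (A `\` S).
Proof.
move=> sS [sA rA]; split=> [x [/sA]//|u v uv].
have [s As su] := rA _ _ uv; exists s => //; split=> // /sS Ss.
by apply: (arc_not_sink uv); rewrite -(reachable_from_sink Ss su).
Qed.

(** By minimality, [A] equals [A] without its sinks. *)
Lemma arc_basis_not_sink A v : arc_basis D A -> A v -> ~ sinks D v.
Proof.
move=> [rA minA].
have <- := minA _ (arc_reaching_setD_sinks (@subset_refl _ _) rA) (@subDsetl _ _ _).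
by case.
Qed.

Lemma point_reaching_arc_reaching A : point_reaching D A -> arc_reaching D A.
Proof.
by move=> [sA rA]; split=> // u v uv; have [Du _] := arcs_vertices uv; exact: rA.
Qed.

Lemma isolates_sub_point_reaching B : point_reaching D B -> isolates D `<=` B.
Proof.
move=> [_ rB] v Iv; have [Dv _ _] := Iv.
by have [s Bs /(reachable_isolate Iv) <-] := rB v Dv.
Qed.

Lemma arc_reaching_setD_isolates B :
  point_reaching D B -> arc_reaching D (B `\` isolates D).
Proof.
move=> /point_reaching_arc_reaching.
exact: (arc_reaching_setD_sinks (@isolates_sub_sinks _ D)).
Qed.

Lemma point_reaching_setU_isolates A :
  arc_reaching D A -> point_reaching D (A `|` isolates D).
Proof.
move=> [sA rA]; split=> [x [/sA|[]]//|v Dv].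
(* A non-sink is reached as a tail, a sink with an in-neighbour through that neighbour; any other
   sink is an isolate and reaches itself. *)
have [Sv|/(not_sink_arc Dv)[w /rA[s As sv]]] := pselect (sinks D v); last first.
  by exists s => //; left.
have [/eqP N0|/set0P[u uv]] := boolP (in_nbrs D v == set0).
  exists v; last exact: reachable_refl.
  by right; split=> //; case: Sv.
have [s As su] := rA _ _ uv.
by exists s; [left|exact: reachable_arc su uv].
Qed.

Lemma arc_reaching_delete_sinksP A : A `<=` vertices D ->
  arc_reaching D A <->
  exists P Q : set V,
    [/\ point_reaching (delete_sinks D) P, Q `<=` sinks D & A = P `|` Q].
Proof.
move=> sA; split=> [[_ rA]|[P [Q [[_ rP] _ AE]]]].
  exists (A `\` sinks D), (A `&` sinks D); split.
  - split=> [x [/sA]//|v [Dv Nv]].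
    have [w /rA[s As sv]] := not_sink_arc Dv Nv.
    have sv' := reachable_delete_sinks Nv sv.
    by exists s => //; split=> //; exact: reachable_delete_sinks_source sv'.
  - exact: subIsetr.
  - by rewrite setUC setUIDK.
split=> // u v uv; have [Du _] := arcs_vertices uv.
have [s Ps su] := rP u (conj Du (arc_not_sink uv)).
by exists s; [rewrite AE; left|exact: reachable_delete_vertices su].
Qed.

Lemma arc_basis_setU_isolates A :
  arc_basis D A -> point_basis D (A `|` isolates D).
Proof.
move=> [rA minA]; split=> [|T rT sT]; first exact: point_reaching_setU_isolates.
(* Minimality of [A] applies to [T] without isolates; as [T] contains every isolate, adding them
   back restores [T]. *)
have <- : T `\` isolates D = A.
  apply: minA; first exact: arc_reaching_setD_isolates.
  by move=> x [/sT[]].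
by rewrite setDKU //; exact: isolates_sub_point_reaching.
Qed.

Lemma point_basis_setD_isolates B :
  point_basis D B -> arc_basis D (B `\` isolates D).
Proof.
move=> [rB minB]; split=> [|T rT sT]; first exact: arc_reaching_setD_isolates.
have <- : T `|` isolates D = B.
  apply: minB; first exact: point_reaching_setU_isolates.
  by move=> x [/sT[]//|]; exact: isolates_sub_point_reaching.
(* [T] avoids the isolates, so adding and then removing them leaves [T]. *)
by apply/seteqP; split=> [x Tx|x [[]]//]; split; [left|have [] := sT x Tx].
Qed.

End Reaching.

Theorem theorem4 (V : Type) (D : digraph V) :
  (forall A : set V, A `<=` vertices D ->
     (arc_reaching D A <->
      exists P Q : set V,
        [/\ point_reaching (delete_sinks D) P, Q `<=` sinks D & A = P `|` Q]))
  /\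
  (forall A : set V,
     arc_basis D A <->
     exists B : set V, point_basis D B /\ A = B `\` isolates D).
Proof.
split=> [A|A]; first exact: arc_reaching_delete_sinksP.
split=> [bA|[B [bB ->]]]; last exact: point_basis_setD_isolates.
exists (A `|` isolates D); split; first exact: arc_basis_setU_isolates.
apply/seteqP; split=> [x Ax|x [[]]//].
by split; [left|move=> Ix; exact: arc_basis_not_sink bA Ax (isolates_sub_sinks Ix)].
Qed.
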